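(* Let $N\ge 1$, let $\tau\in\mathcal{H}$ be a quadratic imaginary point with $\tau^2+D=0$, where $D$ is a square-free positive integer, and suppose that $\tau$ is not an elliptic point (for $\mathrm{SL}(2,\mathbb{Z})$). Let $p$ be a prime number such that $\left(\frac{-D}{p}\right)=-1$. Let $K=\mathbb{C}$ or $\mathbb{Q}_p$ and let $V$ be a $K$-vector space. Then there is an injective $K$-linear map $$\mathrm{Symb}(\Delta_0,V)^{\Gamma_0(N)}\hookrightarrow \mathrm{Symb}(\Delta_0^{\tau,p},V)^{\Gamma_0(N)}.$$
   Context: $\mathcal{H}$ is the complex upper half-plane, on which matrices of positive determinant act by Möbius transformations. A point of $\mathcal{H}$ is elliptic if it is fixed by an elliptic element (non-central, with a fixed point in $\mathcal{H}$) of the group considered. Classical symbols. $\Delta_0=\mathrm{SL}(2,\mathbb{Z})\, i\infty$, i.e. the set of cusps $\mathbb{Q}\cup\{i\infty\}$. A $V$-valued modular symbol is a map $F:\Delta_0\times\Delta_0\to V$ with $F(P,Q)=F(P,R)+F(R,Q)$ for all $P,Q,R\in\Delta_0$. $\mathrm{Symb}(\Delta_0,V)^{\Gamma_0(N)}$ is the $K$-vector space of those that are $\Gamma_0(N)$-invariant: $F(\gamma P,\gamma Q)=F(P,Q)$ for all $\gamma\in\Gamma_0(N)$. $\tau$-modular symbols. Put $\Gamma=\Gamma_0(N)$, $\Gamma^1=\mathrm{SL}(2,\mathbb{Z})$. Let $\gamma_p$ be an integral matrix of determinant $p$ defining the Hecke operator $T_p$, and fix a coset decomposition $\Gamma\gamma_p\Gamma=\bigcup_{a=1}^{d}\gamma_a\Gamma$,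 with $d=[\Gamma:\Gamma\cap\gamma_p\Gamma\gamma_p^{-1}]$. Set $$\Delta_0^{\tau,p}=\bigcup_{n=0}^{\infty}\ \bigcup_{1\le i_1,\dots,i_n\le d}\gamma_{i_1}\cdots\gamma_{i_n}\Gamma^1\tau,\qquad \Gamma(\Delta_0^{\tau,p}\times\Delta_0^{\tau,p})=\{(\gamma\sigma_1,\gamma\sigma_2):\gamma\in\Gamma,\ \sigma_1,\sigma_2\in\Delta_0^{\tau,p}\}.$$ A $V$-valued $\tau$-modular symbol is a map $F:\Gamma(\Delta_0^{\tau,p}\times\Delta_0^{\tau,p})\to V$ such that $F(\gamma P,\gamma Q)=F(\gamma P,\gamma R)+F(\gamma R,\gamma Q)$ for all $P,Q,R\in\Delta_0^{\tau,p}$ and all $\gamma\in\Gamma$. $\mathrm{Symb}(\Delta_0^{\tau,p},V)^{\Gamma}$ is the $K$-vector space of $\tau$-modular symbols that are invariant under $\Gamma$, i.e. $F(\gamma P,\gamma Q)=F(P,Q)$ for all $\gamma\in\Gamma$. *)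

(* Defs.v *)
From HB Require Import structures.
From mathcomp Require Import all_boot all_order all_algebra.
From mathcomp Require Import boolp classical_sets functions cardinality reals.
From mathcomp Require Import complex.

Set Implicit Arguments.
Unset Strict Implicit.
Unset Printing Implicit Defensive.

Import Order.TTheory GRing.Theory Num.Theory.

Local Open Scope classical_set_scope.
Local Open Scope card_scope.
Local Open Scope ring_scope.

Definition squarefree (n : nat) : Prop := forall d : nat, (d ^ 2 %| n)%N -> d = 1%N.

(* Legendre symbol (a/p). Meant for p an odd prime; for p = 2 the value is
   0 or 1, so the value -1 forces p to be odd when p is prime. *)
Definition legendre (a : int) (p : nat) : int :=
  if (p %| a)%Z then 0
  else if [exists x : 'I_p, (x%:Z ^+ 2 == a %[mod p])%Z] then 1
  else -1.

(** * Completions of the rationals *)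

(* |q|_p with the usual normalization |p|_p = 1/p *)
Definition padic_norm (R : realType) (p : nat) (q : rat) : R :=
  if q == 0 then 0
  else p%:R ^ ((logn p `|denq q|)%:Z - (logn p `|numq q|)%:Z).

Record is_absolute_value (R : realType) (K : fieldType) (v : K -> R) : Prop :=
  IsAbsoluteValue {
    absv_ge0 : forall x, 0 <= v x;
    absv_eq0 : forall x, v x = 0 <-> x = 0;
    absvM : forall x y, v (x * y) = v x * v y;
    absvD : forall x y, v (x + y) <= v x + v y }.

(* Q_p is the completion of Q for |.|_p; as a field it is determined up to
   isomorphism by the following. The second clause forces K to have
   characteristic 0, so that ratr is the embedding of Q in K. *)
Definition is_Qp (R : realType) (p : nat) (K : fieldType) : Prop :=
  exists v : K -> R,
  [/\ is_absolute_value v,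
      forall q : rat, v (ratr q) = padic_norm R p q,
      forall (x : K) (e : R), 0 < e -> exists q : rat, v (x - ratr q) < e
    & forall u : nat -> K,
        (forall e : R, 0 < e -> exists n0 : nat,
           forall m n : nat, (n0 <= m)%N -> (n0 <= n)%N -> v (u m - u n) < e) ->
        exists l : K, forall e : R, 0 < e -> exists n0 : nat,
          forall n : nat, (n0 <= n)%N -> v (u n - l) < e].

Definition is_complex_field (R : realType) (K : fieldType) : Prop :=
  exists f : {rmorphism R[i] -> K}, bijective f.

(** * Matrix groups, cosets, Hecke double cosets *)

Definition SL2Z : set 'M[int]_2 := [set g | \det g = 1].

Definition Gamma0 (N : nat) : set 'M[int]_2 :=
  [set g | \det g = 1 /\ (N %| (g 1 0)%R)%Z].

Definition lcoset (g : 'M[int]_2) (H : set 'M[int]_2) : set 'M[int]_2 :=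
  [set g * h | h in H].

Definition double_coset (G : set 'M[int]_2) (g : 'M[int]_2) : set 'M[int]_2 :=
  [set x * g * y | x in G & y in G].

Definition has_index (G H : set 'M[int]_2) (d : nat) : Prop :=
  [set lcoset g H | g in G] #= `I_d.

(* G :&: g G g^-1, without leaving the integral matrices *)
Definition conj_inter (G : set 'M[int]_2) (g : 'M[int]_2) : set 'M[int]_2 :=
  [set x | G x /\ exists2 y, G y & x * g = g * y].

(* T_p is the double coset of diag(1, p) or of diag(p, 1), according to the
   convention; the two agree when p does not divide N. *)
Definition defines_Tp (N p : nat) (g : 'M[int]_2) : Prop :=
  let diag2 (a b : int) : 'M[int]_2 :=
    diag_mx (\row_(i < 2) if i == 0 then a else b) in
  \det g = p%:Z /\
  (double_coset (Gamma0 N) g = double_coset (Gamma0 N) (diag2 1 p%:Z) \/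
   double_coset (Gamma0 N) g = double_coset (Gamma0 N) (diag2 p%:Z 1)).

(* G g G is the union of the gs a G. Disjointness follows from the number d of
   cosets being the index. *)
Definition coset_decomposition (G : set 'M[int]_2) (g : 'M[int]_2) (d : nat)
    (gs : 'I_d -> 'M[int]_2) : Prop :=
  has_index G (conj_inter G g) d /\
  double_coset G g = \bigcup_(a in [set: 'I_d]) lcoset (gs a) G.

(** * Actions *)

(* None is the cusp i oo *)
Definition cusp : Type := option rat.

Definition cusp_act (g : 'M[int]_2) (P : cusp) : cusp :=
  let: (a, b, c, d) :=
    ((g 0 0)%:~R, (g 0 1)%:~R, (g 1 0)%:~R, (g 1 1)%:~R) : rat * rat * rat * rat in
  match P with
  | None => if c == 0 then None else Some (a / c)
  | Some r => if c * r + d == 0 then None else Some ((a * r + b) / (c * r + d))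
  end.

Section Moebius.
Variable R : realType.

Definition upper_half_plane : set R[i] := [set z | 0 < complex.Im z].

(* only meaningful for \det g > 0 and z in the upper half-plane *)
Definition moebius (g : 'M[int]_2) (z : R[i]) : R[i] :=
  ((g 0 0)%:~R * z + (g 0 1)%:~R) / ((g 1 0)%:~R * z + (g 1 1)%:~R).

Definition elliptic_element (G : set 'M[int]_2) (g : 'M[int]_2) : Prop :=
  [/\ G g, ~ (forall h, G h -> g * h = h * g)
    & exists2 z, upper_half_plane z & moebius g z = z].

Definition elliptic_point (G : set 'M[int]_2) (z : R[i]) : Prop :=
  upper_half_plane z /\ exists2 g, elliptic_element G g & moebius g z = z.

Definition Delta_tau (d : nat) (gs : 'I_d -> 'M[int]_2) (tau : R[i]) : set R[i] :=
  [set z | exists (s : seq 'I_d) (h : 'M[int]_2),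
     SL2Z h /\ z = moebius ((\prod_(i <- s) gs i) * h) tau].

Definition sat_pairs (G : set 'M[int]_2) (D : set R[i]) : set (R[i] * R[i]) :=
  [set x | exists g P Q, [/\ G g, D P, D Q & x = (moebius g P, moebius g Q)]].

End Moebius.

(** * Modular symbols *)

Section ModularSymbols.
Variables (K : fieldType) (V : lmodType K) (G : set 'M[int]_2).

Definition is_symb (F : cusp * cusp -> V) : Prop :=
  (forall P Q S, F (P, Q) = F (P, S) + F (S, Q)) /\
  (forall g, G g -> forall P Q, F (cusp_act g P, cusp_act g Q) = F (P, Q)).

Definition symb_pred : {pred cusp * cusp -> V} := fun F => `[< is_symb F >].

Fact symb_submod_closed : submod_closed symb_pred.
Proof.
split=> [|a F F' /asboolP[FA FG] /asboolP[FA' FG']]; apply/asboolP; split.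
- by move=> *; rewrite addr0.
- by [].
- move=> P Q S; change (a *: F (P, Q) + F' (P, Q) =
    a *: F (P, S) + F' (P, S) + (a *: F (S, Q) + F' (S, Q))).
  by rewrite (FA P Q S) (FA' P Q S) scalerDr addrACA.
- move=> g Gg P Q; change (a *: F (cusp_act g P, cusp_act g Q) +
    F' (cusp_act g P, cusp_act g Q) = a *: F (P, Q) + F' (P, Q)).
  by rewrite FG // FG'.
Qed.

HB.instance Definition _ :=
  GRing.isSubmodClosed.Build K (cusp * cusp -> V) symb_pred symb_submod_closed.

(* Symb(Delta_0, V)^G *)
Record symb := Symb { symb_val : cusp * cusp -> V; _ : symb_val \in symb_pred }.

HB.instance Definition _ := [isSub for symb_val].
HB.instance Definition _ := [Choice of symb by <:].
HB.instance Definition _ := [SubChoice_isSubLmodule of symb by <:].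

End ModularSymbols.

Section TauModularSymbols.
Variables (R : realType) (K : fieldType) (V : lmodType K).
Variables (G : set 'M[int]_2) (D : set R[i]).

(* Pairs are elements of the subtype attached to sat_pairs G D; x, y, z below
   are the elements of that subtype with the prescribed underlying pairs. *)
Definition is_tau_symb (F : sat_pairs G D -> V) : Prop :=
  (forall g P Q S, G g -> D P -> D Q -> D S ->
     forall x y z : sat_pairs G D,
       val x = (moebius g P, moebius g Q) ->
       val y = (moebius g P, moebius g S) ->
       val z = (moebius g S, moebius g Q) -> F x = F y + F z) /\
  (forall g, G g -> forall x y : sat_pairs G D,
     val y = (moebius g (val x).1, moebius g (val x).2) -> F y = F x).

Definition tau_symb_pred : {pred sat_pairs G D -> V} :=
  fun F => `[< is_tau_symb F >].

Fact tau_symb_submod_closed : submod_closed tau_symb_pred.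
Proof.
split=> [|a F F' /asboolP[FA FG] /asboolP[FA' FG']]; apply/asboolP; split.
- by move=> *; rewrite addr0.
- by [].
- move=> g P Q S Gg DP DQ DS x y z xE yE zE.
  change (a *: F x + F' x = a *: F y + F' y + (a *: F z + F' z)).
  rewrite (FA _ _ _ _ Gg DP DQ DS _ _ _ xE yE zE).
  by rewrite (FA' _ _ _ _ Gg DP DQ DS _ _ _ xE yE zE) scalerDr addrACA.
- move=> g Gg x y yE; change (a *: F y + F' y = a *: F x + F' x).
  by rewrite (FG _ Gg _ _ yE) (FG' _ Gg _ _ yE).
Qed.

HB.instance Definition _ :=
  GRing.isSubmodClosed.Build K (sat_pairs G D -> V) tau_symb_pred
    tau_symb_submod_closed.

(* Symb(D, V)^G *)
Record tau_symb :=
  TauSymb { tau_symb_val : sat_pairs G D -> V; _ : tau_symb_val \in tau_symb_pred }.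

HB.instance Definition _ := [isSub for tau_symb_val].
HB.instance Definition _ := [Choice of tau_symb by <:].
HB.instance Definition _ := [SubChoice_isSubLmodule of tau_symb by <:].

End TauModularSymbols.

(* Main.v *)
Require Import Defs.
From HB Require Import structures.
From mathcomp Require Import all_boot all_order all_algebra.
From mathcomp Require Import boolp classical_sets functions cardinality reals.
From mathcomp Require Import complex.
From mathcomp Require Import ring lra.

Import Order.TTheory GRing.Theory Num.Theory.

Local Open Scope classical_set_scope.
Local Open Scope ring_scope.

(** The points of the p-power orbit of tau are the M tau with M an integral
    matrix whose determinant is a power of p.  The map psi : M tau |-> M oo
    sends them to cusps, and a classical symbol F is sent to the tau-symbol
    (z, w) |-> F (psi z, psi w).

    Everything rests on psi being well defined ([cusp_belowE]).  If
    M tau = M' tau, then adj(M') M fixes tau; an integral matrix fixing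
    sqrt(-D) has the form (a, -D c; c, a), so its determinant gives
    a^2 + D c^2 = p^k ([moebius_eq_norm_form]).  As -D is not a square modulo p,
    p divides both a and c whenever k > 0, and dividing by p^2 one descends to
    a^2 + D c^2 = 1, where c = 0 because D > 1 ([norm_form_prime_power]).
    The inequality D > 1 holds because tau is not elliptic: the case D = 1 is
    that of the elliptic point i ([not_elliptic_gt1]).  The vanishing of the lower-left entry c of adj(M') M
    means that the first columns of M and M' are proportional, which is
    M oo = M' oo ([cusp_act_eq]).

    Since psi commutes with matrices of determinant 1 ([cusp_below_act]), the
    pullback of an invariant symbol is invariant, and its additivity is that
    of F.  The pullback is injective because SL(2,Z) is transitive on the
    cusps: every pair of cusps is (h oo, h' oo) = (psi (h tau), psi (h' tau))
    ([pullback_inj]). *)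

(** * Two by two matrices *)

Lemma mulmx22E (A : pzRingType) (g h : 'M[A]_2) (i j : 'I_2) :
  (g * h) i j = g i 0 * h 0 j + g i 1 * h 1 j.
Proof.
rewrite -mulmxE mxE !big_ord_recl big_ord0 addr0.
by rewrite (_ : lift ord0 ord0 = 1) //; apply: val_inj.
Qed.

Lemma det22E (A : comPzRingType) (g : 'M[A]_2) :
  \det g = g 0 0 * g 1 1 - g 0 1 * g 1 0.
Proof.
rewrite (expand_det_row _ 0) !big_ord_recl big_ord0 addr0 /cofactor !det_mx11.
rewrite !mxE /= expr0 expr1 mul1r mulN1r mulrN.
by congr (g _ _ * g _ _ - g _ _ * g _ _); apply: val_inj.
Qed.

(** * The norm form of an inert prime *)

(** If p did not divide c, then a / c would be a square root of -D modulo p. *)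
Lemma inert_dvd_norm_form {p D : nat} {a c : int} (hp : prime p)
    (hDp : legendre (- D%:Z) p = -1) :
  (p %| a ^+ 2 + D%:Z * c ^+ 2)%Z -> (p %| a)%Z /\ (p %| c)%Z.
Proof.
move=> hpn; have hpc : (p %| c)%Z.
  apply: contraTT isT => hpc.
  have : coprimez c p%:Z.
    by rewrite coprimez_sym coprimezE absz_nat prime_coprime.
  case/coprimezP => -[u v] /= huv.
  have hv : v * p%:Z = 1 - u * c by rewrite -huv addrC addKr.
  have p0 : p%:Z != 0 by rewrite eqz_nat -lt0n prime_gt0.
  have hx : (`|((u * a) %% p)%Z|%N < p)%N.
    by rewrite -ltz_nat gez0_abs ?modz_ge0 // ltz_mod.
  move: hDp; rewrite /legendre; case: ifP => // _.
  case: existsP => // -[]; exists (Ordinal hx).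
  rewrite /= gez0_abs ?modz_ge0 // modzXm eqz_mod_dvd.
  (* multiply the relation by u^2, where u inverts c modulo p *)
  have -> : (u * a) ^+ 2 - - D%:Z =
      u ^+ 2 * (a ^+ 2 + D%:Z * c ^+ 2) + (1 + u * c) * D%:Z * (v * p%:Z).
    by rewrite hv; ring.
  by rewrite rpredD // dvdz_mull // dvdz_mull.
split=> //; move: hpn; rewrite rpredDr; last by rewrite dvdz_mull // dvdz_mulr.
by rewrite !dvdzE abszX !absz_nat Euclid_dvdX // => /andP[].
Qed.

(** Infinite descent in steps of 2 on the exponent: p divides a and c, and
    a / p, c / p represent p^(k-2). *)
Lemma norm_form_prime_power {p D : nat} (hp : prime p)
    (hDp : legendre (- D%:Z) p = -1) (hD : (1 < D)%N) k (a c : int) :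
  a ^+ 2 + D%:Z * c ^+ 2 = p%:Z ^+ k -> c = 0.
Proof.
have p_gt0 := prime_gt0 hp.
have descend j x y : x ^+ 2 + D%:Z * y ^+ 2 = p%:Z ^+ j.+1 ->
    exists x' y', y = y' * p%:Z /\
      (x' ^+ 2 + D%:Z * y' ^+ 2) * p%:Z = p%:Z ^+ j.
  move=> hxy; have [] := inert_dvd_norm_form (a := x) (c := y) hp hDp.
    by rewrite hxy exprS dvdz_mulr.
  move=> /dvdzP[x' hx] /dvdzP[y' hy]; exists x', y'; split=> //.
  have p0 : p%:Z != 0 by rewrite eqz_nat -lt0n.
  by apply: (mulIf p0); rewrite -exprSr -hxy hx hy; ring.
elim/ltn_ind: k a c => -[|[|k]] IH a c hac.
(* c <> 0 would give a^2 + D c^2 >= D > 1 *)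
- apply: contraPeq hac => c0.
  have c2 : 1 <= c ^+ 2 by rewrite -gtz0_ge1 exprn_even_gt0.
  have D2 : 2 <= D%:Z by [].
  have a2 : 0 <= a ^+ 2 by rewrite sqr_ge0.
  by rewrite expr0; nra.
(* the exponent 1 is impossible: p would divide 1 *)
- have [a' [c' [_]]] := descend 0%N a c hac.
  move=> /(congr1 (fun x => (p %| x)%Z)); rewrite dvdz_mull //.
  by rewrite dvdzE absz_nat expr0 Euclid_dvd1.
- have [a' [c' [-> hac']]] := descend k.+1 a c hac.
  rewrite (IH k _ a' c') ?mul0r 1?ltnW //.
  have p0 : p%:Z != 0 by rewrite eqz_nat -lt0n.
  by apply: (mulIf p0); rewrite hac' exprSr.
Qed.

(** * Moebius transformations and cusps *)

(** tau is a square root of a negative integer, so it is not rational: from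
    u tau = - v one gets D u^2 + v^2 = 0, a sum of two nonnegative integers. *)
Lemma coef_eq0 {L : numFieldType} {tau : L} {D : nat} {u v : int} :
  (0 < D)%N -> tau ^+ 2 + D%:R = 0 -> u%:~R * tau + v%:~R = 0 ->
  u = 0 /\ v = 0.
Proof.
move=> hD htau huv.
have : (D%:Z * u ^+ 2 + v ^+ 2)%:~R = 0 :> L.
  have tauE : tau ^+ 2 = - D%:R by apply/eqP; rewrite -addr_eq0 htau.
  have vE : v%:~R = - (u%:~R * tau) by apply/eqP; rewrite -addr_eq0 addrC huv.
  by rewrite rmorphD rmorphM !rmorphXn /= vE sqrrN exprMn tauE; ring.
move/eqP; rewrite intr_eq0 paddr_eq0 ?sqr_ge0 //; last first.
  by rewrite mulr_ge0 // sqr_ge0.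
by rewrite mulf_eq0 !sqrf_eq0 eqz_nat eqn0Ngt hD /= => /andP[/eqP-> /eqP->].
Qed.

(** Nonsingularity of h keeps its first column, which represents the cusp h oo,
    away from zero. *)
Lemma cusp_actM (g h : 'M[int]_2) : \det h != 0 ->
  cusp_act (g * h) None = cusp_act g (cusp_act h None).
Proof.
rewrite /cusp_act !mulmx22E !rmorphD !rmorphM /= => det_h.
have [h10|h10] := eqVneq ((h 1 0)%:~R : rat) 0.
  (* h oo = oo, and g h has the first column of g times the entry h 0 0 *)
  have h00 : (h 0 0)%:~R != 0 :> rat.
    apply: contraNneq det_h => /eqP; rewrite intr_eq0 => /eqP h00.
    move/eqP: h10; rewrite intr_eq0 => /eqP h10.
    by rewrite det22E h00 h10 mul0r mulr0 subrr.
  rewrite h10 !mulr0 !addr0 mulf_eq0 (negbTE h00) orbF.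
  by case: eqP => // /eqP g10; rewrite -mulf_div divff // mulr1.
have fracE (x y : rat) : x * ((h 0 0)%:~R / (h 1 0)%:~R) + y =
    (x * (h 0 0)%:~R + y * (h 1 0)%:~R) / (h 1 0)%:~R.
  by rewrite mulrDl mulfK // mulrA.
rewrite !fracE mulf_eq0 invr_eq0 (negbTE h10) orbF.
by case: eqP => // _; rewrite invf_div mulrA mulfVK.
Qed.

(** A Bezout relation for the numerator and denominator of a rational completes
    them to a matrix of determinant 1. *)
Lemma cusp_act_transitive (P : cusp) :
  exists2 h, SL2Z h & cusp_act h None = P.
Proof.
case: P => [q|]; last first.
  exists 1; first exact: det1.
  by rewrite /cusp_act /= mxE.
have : coprimez (numq q) (denq q) by rewrite coprimezE coprime_num_den.
case/coprimezP => -[u v] /= huv.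
exists (\matrix_(i, j) if i == 0 then if j == 0 then numq q else - v
                       else if j == 0 then denq q else u).
  by rewrite /SL2Z /= det22E !mxE /= -huv; ring.
by rewrite /cusp_act !mxE /= intr_eq0 (negbTE (denq_neq0 q)) divq_num_den.
Qed.

Section BasePoint.
Context {R : realType} {D : nat} {tau : R[i]}.
Hypotheses (hD0 : (0 < D)%N) (htau : tau ^+ 2 + D%:R = 0).

Lemma moebius_den_neq0 (h : 'M[int]_2) : \det h != 0 ->
  (h 1 0)%:~R * tau + (h 1 1)%:~R != 0.
Proof.
apply: contraNneq => /(coef_eq0 hD0 htau)[h10 h11].
by rewrite det22E h10 h11 !mulr0 subrr.
Qed.

Lemma moebiusM (g h : 'M[int]_2) : \det h != 0 ->
  moebius (g * h) tau = moebius g (moebius h tau).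
Proof.
move=> /moebius_den_neq0; rewrite /moebius !mulmx22E !rmorphD !rmorphM /=.
set w := _ + _%:~R => w0.
have fracE (x y n : R[i]) : x * (n / w) + y = (x * n + y * w) / w.
  by rewrite mulrDl mulfK // mulrA.
rewrite !fracE invf_div mulrA mulfVK // /w.
by congr (_ / _); ring.
Qed.

(** Here a and c are the diagonal and lower-left entries of adj(M') M, a matrix
    that fixes tau.  Clearing denominators in M tau = M' tau and separating the
    coefficients of tau and 1 shows that its two diagonal entries agree and that
    its upper-right entry is - D c, so its determinant is a^2 + D c^2. *)
Lemma moebius_eq_norm_form (M M' : 'M[int]_2) :
  \det M != 0 -> \det M' != 0 -> moebius M tau = moebius M' tau ->
  let a := M 0 0 * M' 1 1 - M 1 0 * M' 0 1 in
  let c := M' 0 0 * M 1 0 - M' 1 0 * M 0 0 in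
  a ^+ 2 + D%:Z * c ^+ 2 = \det M * \det M'.
Proof.
move=> /moebius_den_neq0 dM /moebius_den_neq0 dM' eqM a c.
have /(coef_eq0 hD0 htau)[diag offdiag] :
    (a - (M' 0 0 * M 1 1 - M 0 1 * M' 1 0))%:~R * tau
    + (M 0 1 * M' 1 1 - M' 0 1 * M 1 1 + D%:Z * c)%:~R = 0.
  have tauE : D%:R = - tau ^+ 2 by apply/eqP; rewrite -addr_eq0 addrC htau.
  move/eqP: eqM; rewrite /moebius eqr_div // -subr_eq0 => /eqP <-.
  rewrite !(rmorphD, rmorphN, rmorphM) /= -[D%:Z%:~R]/(D%:R) tauE; ring.
have aE : a ^+ 2 = a * (M' 0 0 * M 1 1 - M 0 1 * M' 1 0).
  by rewrite expr2 {2}(subr0_eq diag).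
have DcE : D%:Z * c = M' 0 1 * M 1 1 - M 0 1 * M' 1 1.
  by apply/eqP; rewrite -subr_eq0 -offdiag; apply/eqP; ring.
by rewrite aE (expr2 c) mulrA DcE !det22E /a /c; ring.
Qed.

(** For D = 1 the rotation z |-> -1/z fixes tau, and it is not central. *)
Lemma not_elliptic_gt1 :
  upper_half_plane tau -> ~ elliptic_point SL2Z tau -> (1 < D)%N.
Proof.
move=> tauH; apply: contra_notT; rewrite -leqNgt => D1.
have {D1}D1 : D = 1%N by apply/eqP; rewrite eqn_leq D1.
have tau0 : tau != 0.
  by apply: contraTneq tauH => ->; rewrite /upper_half_plane /= ltxx.
pose s : 'M[int]_2 := \matrix_(i, j) if i == 0 then (if j == 0 then 0 else -1)
                                     else if j == 0 then 1 else 0.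
have sfix : moebius s tau = tau.
  rewrite /moebius !mxE /= mul0r mul1r add0r addr0 mulrN1z.
  apply: (mulIf tau0); rewrite mulfVK // -expr2.
  by apply/esym/eqP; rewrite -addr_eq0; move/eqP: htau; rewrite D1.
split=> //; exists s => //; split; last by exists tau.
  by rewrite /SL2Z /= det22E !mxE /=; ring.
(* s does not commute with the translation z |-> z + 1 *)
pose t : 'M[int]_2 := \matrix_(i, j) if i == 0 then 1 else (j != 0)%:R.
move=> /(_ t); rewrite /SL2Z /= det22E !mxE /= => /(_ erefl).
by move/matrixP/(_ 0 0); rewrite !mulmx22E !mxE.
Qed.

End BasePoint.

(** * The cusp attached to a point of the p-power orbit *)

Definition ppow_det (p : nat) (M : 'M[int]_2) : Prop :=
  exists n, \det M = p%:Z ^+ n.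

(** The map psi : M tau |-> M oo, through an arbitrary choice of M; the matrix 0
    is only a default for the points outside the p-power orbit of tau. *)
Definition cusp_below {R : realType} (p : nat) (tau z : R[i]) : cusp :=
  cusp_act (xget 0 [set M | ppow_det p M /\ moebius M tau = z]) None.

(** The hypothesis says that the first columns of M and M', which are nonzero,
    are proportional. *)
Lemma cusp_act_eq (M M' : 'M[int]_2) : \det M != 0 -> \det M' != 0 ->
  M' 0 0 * M 1 0 = M' 1 0 * M 0 0 -> cusp_act M None = cusp_act M' None.
Proof.
have first_col (L : 'M[int]_2) : \det L != 0 -> L 1 0 = 0 -> L 0 0 != 0.
  move=> + L10; apply: contraNneq => L00.
  by rewrite det22E L10 L00 mulr0 mul0r subrr.
rewrite /cusp_act !intr_eq0 => dM dM' eqc.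
have [M10|M10] := eqVneq (M 1 0) 0.
  move/eqP: eqc; rewrite M10 mulr0 eq_sym mulf_eq0.
  by rewrite (negbTE (first_col _ dM M10)) orbF => ->.
have [M'10|M'10] := eqVneq (M' 1 0) 0.
  move/eqP: eqc; rewrite M'10 mul0r mulf_eq0 (negbTE M10) orbF.
  by rewrite (negbTE (first_col _ dM' M'10)).
congr Some; apply/eqP; rewrite eqr_div ?intr_eq0 // -!intrM eqr_int.
by rewrite mulrC -eqc mulrC.
Qed.

(** Each gs i lies in the double coset of gp, hence has determinant p. *)
Lemma Delta_tau_ppow {R : realType} {N p d : nat} {gp : 'M[int]_2}
    {gs : 'I_d -> 'M[int]_2} {tau z : R[i]} :
  \det gp = p%:Z -> coset_decomposition (Gamma0 N) gp gs ->
  Delta_tau gs tau z -> exists2 M, ppow_det p M & z = moebius M tau.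
Proof.
move=> det_gp [_ cosets] [s [h [det_h ->]]].
exists ((\prod_(i <- s) gs i) * h) => //.
have Gamma01 : Gamma0 N 1 by split; rewrite ?det1 // mxE dvdz0.
have det_gs i : \det (gs i) = p%:Z.
  have : (\bigcup_(a in [set: 'I_d]) lcoset (gs a) (Gamma0 N)) (gs i).
    by exists i => //; exists 1 => //; rewrite mulr1.
  rewrite -cosets => -[x [det_x _] [y [det_y _] <-]].
  by rewrite !det_mulmx det_x det_y mul1r mulr1.
exists (size s); rewrite det_mulmx det_h mulr1.
elim: s => [|i s IHs]; first by rewrite big_nil det1.
by rewrite big_cons det_mulmx det_gs IHs exprS.
Qed.

Section CuspBelow.
Context {R : realType} {D p : nat} {tau : R[i]}.
Hypotheses (htau : tau ^+ 2 + D%:R = 0) (hD : (1 < D)%N).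
Hypotheses (hp : prime p) (hDp : legendre (- D%:Z) p = -1).

Lemma ppow_det_neq0 M : ppow_det p M -> \det M != 0.
Proof.
by move=> [n ->]; rewrite expf_neq0 // eqz_nat -lt0n prime_gt0.
Qed.

Lemma cusp_belowE M : ppow_det p M ->
  cusp_below p tau (moebius M tau) = cusp_act M None.
Proof.
move=> ppM; rewrite /cusp_below; set S := [set _ | _].
have [] : S (xget 0 S) by apply: xgetPex; exists M.
move: (xget 0 S) => {S} M' ppM' eqM.
have dM := ppow_det_neq0 _ ppM; have dM' := ppow_det_neq0 _ ppM'.
have /= := moebius_eq_norm_form (ltnW hD) htau _ _ dM' dM eqM.
case: ppM ppM' => n -> [n' ->]; rewrite -exprD.
move=> /(norm_form_prime_power hp hDp hD) /subr0_eq.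
exact: cusp_act_eq.
Qed.

Lemma cusp_below_act g M : \det g = 1 -> ppow_det p M ->
  cusp_below p tau (moebius g (moebius M tau)) =
  cusp_act g (cusp_below p tau (moebius M tau)).
Proof.
move=> det_g ppM; have dM := ppow_det_neq0 _ ppM.
rewrite -(moebiusM (ltnW hD) htau) // !cusp_belowE ?cusp_actM //.
by case: ppM => n det_M; exists n; rewrite det_mulmx det_g mul1r.
Qed.

End CuspBelow.

(** * Pulling symbols back along psi *)

Section Pullback.
Context {R : realType} {D p N d : nat} {tau : R[i]}.
Context {gp : 'M[int]_2} {gs : 'I_d -> 'M[int]_2}.
Context {K : fieldType} {V : lmodType K}.
Hypotheses (htau : tau ^+ 2 + D%:R = 0) (hD : (1 < D)%N).
Hypotheses (hp : prime p) (hDp : legendre (- D%:Z) p = -1).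
Hypotheses (det_gp : \det gp = p%:Z).
Hypotheses (hgs : coset_decomposition (Gamma0 N) gp gs).

Local Notation psi := (cusp_below p tau).
Local Notation pairs := (sat_pairs (Gamma0 N) (Delta_tau gs tau)).

Definition pullback (F : cusp * cusp -> V) (x : pairs) : V :=
  F (psi (val x).1, psi (val x).2).

(** Additivity of F holds for all triples of cusps; only the invariance uses
    that the points concerned belong to the p-power orbit, where psi is
    equivariant. *)
Lemma pullback_is_tau_symb F : is_symb (Gamma0 N) F -> is_tau_symb (pullback F).
Proof.
move=> [Fadd Finv]; split=> [g P Q S _ _ _ _ x y z xE yE zE|g Gg x y yE].
  by rewrite /pullback xE yE zE /=; apply: Fadd.
have ppow_orbit h z : Gamma0 N h -> Delta_tau gs tau z ->
    exists2 M, ppow_det p M & moebius h z = moebius M tau.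
  move=> [det_h _] /(Delta_tau_ppow det_gp hgs)[M ppM ->]; exists (h * M).
    by case: ppM => n det_M; exists n; rewrite det_mulmx det_h mul1r.
  by rewrite (moebiusM (ltnW hD) htau) // (ppow_det_neq0 hp).
rewrite /pullback yE /=.
have /set_mem[h [P [Q [Gh /(ppow_orbit h _ Gh)[M ppM PE]]]]] := valP x.
move=> /(ppow_orbit h _ Gh)[M' ppM' QE] ->; rewrite /= PE QE.
by rewrite !(cusp_below_act htau hD hp hDp) ?Finv //; case: Gg.
Qed.

(** The empty product of the gs i puts every h tau, with h in SL(2,Z), among the
    points considered, and psi (h tau) = h oo runs over all cusps. *)
Lemma pullback_inj F F' : pullback F = pullback F' -> F = F'.
Proof.
move=> eqF; apply/funext => -[P Q].
have [h det_h <-] := cusp_act_transitive P.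
have [h' det_h' <-] := cusp_act_transitive Q.
have ppow1 g : SL2Z g -> ppow_det p g by exists 0%N.
have in_Delta g : SL2Z g -> Delta_tau gs tau (moebius g tau).
  by move=> det_g; exists [::], g; rewrite big_nil mul1r.
have moebius1 z : moebius 1 z = z :> R[i].
  by rewrite /moebius !mxE /= mul1r mul0r addr0 add0r divr1.
have hx : (moebius h tau, moebius h' tau) \in pairs.
  apply/mem_set; exists 1, (moebius h tau), (moebius h' tau).
  split; rewrite ?moebius1; try exact: in_Delta; last by [].
  by split; rewrite ?det1 // mxE dvdz0.
move/(congr1 (fun f => f (SigSub hx))): eqF; rewrite /pullback /=.
by rewrite !(cusp_belowE htau hD hp hDp) //; apply: ppow1.
Qed.

Definition symb_pullback (F : symb V (Gamma0 N)) :
    tau_symb V (Gamma0 N) (Delta_tau gs tau) :=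
  TauSymb (introT (asboolP _) (pullback_is_tau_symb _ (asboolW (valP F)))).

Fact symb_pullback_is_linear : linear symb_pullback.
Proof. by move=> a F F'; apply: val_inj; apply/funext. Qed.

HB.instance Definition _ :=
  GRing.isLinear.Build K _ _ _ symb_pullback symb_pullback_is_linear.

End Pullback.

Theorem proposition3p6 (R : realType) (N : nat) (hN : (1 <= N)%N)
    (D : nat) (hD0 : (0 < D)%N) (hD : squarefree D)
    (tau : R[i]) (htauH : upper_half_plane tau) (htau : tau ^+ 2 + D%:R = 0)
    (htau_ell : ~ elliptic_point SL2Z tau)
    (p : nat) (hp : prime p) (hDp : legendre (- D%:Z) p = -1)
    (gp : 'M[int]_2) (hgp : defines_Tp N p gp)
    (d : nat) (gs : 'I_d -> 'M[int]_2)
    (hgs : coset_decomposition (Gamma0 N) gp gs)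
    (K : fieldType) (hK : is_complex_field R K \/ is_Qp R p K)
    (V : lmodType K) :
  exists f : {linear symb V (Gamma0 N) ->
                     tau_symb V (Gamma0 N) (Delta_tau gs tau)},
    injective f.
Proof.
have D_gt1 := not_elliptic_gt1 hD0 htau htauH htau_ell.
exists (symb_pullback htau D_gt1 hp hDp hgp.1 hgs).
move=> F F' /(congr1 val) eqF; apply: val_inj.
exact: (pullback_inj htau D_gt1 hp hDp _ _ eqF).
Qed.
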